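(* Fix $R_{\rm eff}>0$ and assume that all link SNRs $\gamma^{SR}_k,\gamma^{SD}_k,\gamma^{RD}_k$, $k=1,\dots,K$, are mutually independent, and that in every slot the SNR of link $\mathsf{XY}\in\{SR,SD,RD\}$ has the truncated exponential density $f(\gamma)=c\,e^{-\gamma/\bar\gamma^{\mathsf{XY}}}$ for $\gamma\ge\gamma_{tr}$ and $0$ otherwise, with $c=e^{\gamma_{tr}/\bar\gamma^{\mathsf{XY}}}/\bar\gamma^{\mathsf{XY}}$, a common threshold $\gamma_{tr}>0$ and fixed parameters $\bar\gamma^{SR},\bar\gamma^{SD},\bar\gamma^{RD}>0$. Then: (i) without relaying, for every $K\ge1$, $\bar J^{\text{no relay}}_K(R_{\rm eff})\to\infty$ as $\gamma_{tr}\to0^+$; (ii) with relaying, for every $K\ge2$, $\bar J_K(R_{\rm eff})$ remains bounded as $\gamma_{tr}\to0^+$ (i.e. $\limsup_{\gamma_{tr}\to0^+}\bar J_K(R_{\rm eff})<\infty$).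
   Context: Notation: $I(x)=\log(1+x)$, $I^{-1}(x)=e^x-1$, $\tilde\gamma_k=\max(\gamma^{SD}_k,\gamma^{RD}_k)$. Relay problem with $K$ slots and message size $B=KR_{\rm eff}$ nats: in slot $k$ the link SNRs are $(\gamma^{SR}_k,\gamma^{SD}_k,\gamma^{RD}_k)$; a power $p_k\ge0$ is chosen causally (as a function of the SNRs of slots $1,\dots,k$). Remaining information: $b^R_1=b^D_1=B$; if $b^R_k>0$ (Phase 1, the source transmits) then $b^R_{k+1}=b^R_k-I(p_k\gamma^{SR}_k)$, $b^D_{k+1}=b^D_k-I(p_k\gamma^{SD}_k)$; if $b^R_k\le0$ (Phase 2, whichever of source/relay has the larger SNR to the destination transmits) then $b^R_{k+1}=b^R_k$, $b^D_{k+1}=b^D_k-I(p_k\tilde\gamma_k)$. The constraint is $b^D_{K+1}\le0$ a.s. The normalized minimum expected sum energy (NMESE) is $\bar J_K(R_{\rm eff})=\frac1K\mathbb{E}_{\boldsymbol\gamma_1}[J^\star(\boldsymbol\gamma_1)]$, where $J^\star(\boldsymbol\gamma_1)$ is the infimum over causal feasible policies of $\mathbb{E}[\sum_{k=1}^Kp_k\mid\boldsymbol\gamma_1]$. ''No relaying'' means the relay never assists, i.e. the same problem with $\gamma^{SR}_k\equiv0$ (so Phase 2 never occurs and the constraint is $\sum_k I(p_k\gamma^{SD}_k)\ge B$); its NMESE is denoted $\bar J^{\text{no relay}}_K(R_{\rm eff})$. *)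

(* Defs.v *)
From HB Require Import structures.
From mathcomp Require Import all_boot all_order all_algebra.
From mathcomp Require Import all_classical all_reals all_analysis.
Set Implicit Arguments. Unset Strict Implicit. Unset Printing Implicit Defensive.
Import Order.TTheory GRing.Theory Num.Theory.
Import numFieldNormedType.Exports.
Local Open Scope classical_set_scope.
Local Open Scope ring_scope.

Definition slotT (R : realType) := ((R * R) * R)%type.
Definition gSRof (R : realType) (g : slotT R) : R := g.1.1.
Definition gSDof (R : realType) (g : slotT R) : R := g.1.2.
Definition gRDof (R : realType) (g : slotT R) : R := g.2.

Definition Icap (R : realType) (x : R) : R := ln (1 + x).

Definition relay_obs (R : realType) (g : slotT R) : slotT R := g.
Definition norelay_obs (R : realType) (g : slotT R) : slotT R := ((0, g.1.2), g.2).

Definition step (R : realType) (b : R * R) (g : slotT R) (pk : R) : R * R :=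
  if 0 < b.1 then (b.1 - Icap (pk * gSRof g), b.2 - Icap (pk * gSDof g))
  else (b.1, b.2 - Icap (pk * Num.max (gSDof g) (gRDof g))).

(* causal policies: the power of slot k (0-indexed) is a function of the SNRs
   of slots 0..k *)
Definition policy (R : realType) := forall k : nat, (k.+1).-tuple (slotT R) -> R.

Definition hist (R : realType) (w : nat -> slotT R) (k : nat) : (k.+1).-tuple (slotT R) :=
  [tuple w (nat_of_ord i) | i < k.+1].

(* remaining information (b^R_{k+1}, b^D_{k+1}) after k slots *)
Fixpoint bstate (R : realType) (obs : slotT R -> slotT R) (B : R) (p : policy R)
    (w : nat -> slotT R) (k : nat) : R * R :=
  match k with
  | 0 => (B, B)
  | k'.+1 => step (bstate obs B p w k') (obs (w k')) (p k' (hist (obs \o w) k'))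
  end.

Definition dens (R : realType) (gtr gbar x : R) : R :=
  if gtr <= x then expR (gtr / gbar) / gbar * expR (- x / gbar) else 0.

Definition Eslot (R : realType) (gSR gSD gRD gtr : R) (h : slotT R -> \bar R) : \bar R :=
  (\int[lebesgue_measure]_a ((dens gtr gSR a)%:E *
    \int[lebesgue_measure]_b ((dens gtr gSD b)%:E *
      \int[lebesgue_measure]_c ((dens gtr gRD c)%:E * h ((a, b), c)))))%E.

Definition upd (R : realType) (w : nat -> slotT R) (j : nat) (s : slotT R) : nat -> slotT R :=
  fun i => if i == j then s else w i.

(* expectation over the (independent) slots j, j+1, ..., j+n-1, the other
   slots being fixed by w *)
Fixpoint Eiter (R : realType) (gSR gSD gRD gtr : R) (n j : nat)
    (g : (nat -> slotT R) -> \bar R) (w : nat -> slotT R) : \bar R :=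
  match n with
  | 0 => g w
  | n'.+1 => Eslot gSR gSD gRD gtr (fun s => Eiter gSR gSD gRD gtr n' j.+1 g (upd w j s))
  end.

(* admissible (causal, measurable, nonnegative) policies that meet
   b^D_{K+1} <= 0 almost surely, conditionally on the first slot's SNRs g1 *)
Definition admissible (R : realType) (obs : slotT R -> slotT R) (K : nat)
    (B gSR gSD gRD gtr : R) (g1 : slotT R) (p : policy R) : Prop :=
  (forall k, measurable_fun setT (p k)) /\
  (forall k h, 0 <= p k h) /\
  Eiter gSR gSD gRD gtr K.-1 1
    (fun w => if (bstate obs B p w K).2 <= 0 then 0%E else 1%E) (fun _ => g1) = 0%E.

Definition Jstar (R : realType) (obs : slotT R -> slotT R) (K : nat)
    (B gSR gSD gRD gtr : R) (g1 : slotT R) : \bar R :=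
  ereal_inf [set Eiter gSR gSD gRD gtr K.-1 1
                (fun w => (\sum_(k < K) p k (hist (obs \o w) k))%:E) (fun _ => g1)
            | p in admissible obs K B gSR gSD gRD gtr g1].

Definition NMESE (R : realType) (obs : slotT R -> slotT R) (K : nat)
    (Reff gSR gSD gRD gtr : R) : \bar R :=
  ((K%:R)^-1%:E * Eslot gSR gSD gRD gtr (Jstar obs K (K%:R * Reff) gSR gSD gRD gtr))%E.

(* Main.v *)
Require Import Defs.
From HB Require Import structures.
From mathcomp Require Import all_boot all_order all_algebra.
From mathcomp Require Import all_classical all_reals all_analysis.
From mathcomp Require Import measurable_realfun ring lra.
Import Order.TTheory GRing.Theory Num.Theory.
Import numFieldNormedType.Exports.
Local Open Scope classical_set_scope.
Local Open Scope ring_scope.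
Set Implicit Arguments. Unset Strict Implicit. Unset Printing Implicit Defensive.

(** Without relaying, add to the sum power an infinite penalty for outage, and
let V(n, b) be the least penalised cost over n slots with b nats remaining. As
gtr -> 0, V(n, b) tends to infinity for every b > 0, by induction on n: either
the current slot delivers b/2 nats, at a power of at least
C / gamma_SD with C = e^(b/2) - 1, or b/2 nats are left to the other slots. Thus
V(n+1, b) >= E[min(C / gamma_SD, A)] as soon as V(n, b/2) >= A, and this is of
order log A once gtr is small, because 1/x is not integrable at 0.

With relaying, two slots suffice: spending (e^B - 1)/sqrt(gamma_SR gamma_SD) in
the first and (e^B - 1)/sqrt(gamma_SD gamma_RD) in the second delivers the
message, and E[gamma^(-1/2)] is bounded uniformly in gtr. *)

(** * Integrals against the truncated exponential density *)

(* Jstar is not known to be measurable, so ge0_le_integral does not apply. *)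
Lemma le_integral_lower d (T : measurableType d) (R : realType)
    (mu : {measure set T -> \bar R}) (f1 f2 : T -> \bar R) :
  (forall x, 0 <= f1 x)%E -> (forall x, f1 x <= f2 x)%E ->
  (\int[mu]_x f1 x <= \int[mu]_x f2 x)%E.
Proof.
move=> f1_ge0 f12; have f2_ge0 x : (0 <= f2 x)%E by exact: le_trans (f12 x).
rewrite !ge0_integralE//; apply: le_ereal_sup => _ [h /= hf <-].
exists h => //= x; apply: le_trans (hf x) _.
by rewrite !patch_setT.
Qed.

Lemma mem_set_itv (R : realType) (i : interval R) (x : R) :
  (x \in [set` i]) = (x \in i).
Proof. by apply/idP/idP => [/set_mem|xi] //; exact: mem_set. Qed.

Section density.
Variable R : realType.
Implicit Types (t g x : R) (f : R -> \bar R).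

Definition Edens t g f : \bar R :=
  (\int[lebesgue_measure]_x ((dens t g x)%:E * f x))%E.

Lemma dens_ge0 t g x : 0 < g -> 0 <= dens t g x.
Proof.
move=> g0; rewrite /dens; case: ifP => // _.
by rewrite !mulr_ge0 ?expR_ge0 ?invr_ge0 ?ltW.
Qed.

Lemma dens_lt t g x : x < t -> dens t g x = 0.
Proof. by move=> xt; rewrite /dens leNgt xt. Qed.

Lemma measurable_dens t g : measurable_fun setT (dens t g).
Proof.
apply: measurable_fun_ifT => //; first exact: measurable_fun_ler.
apply: measurable_funM => //; apply: measurableT_comp => //.
by apply: measurable_funM => //; exact: measurable_funN.
Qed.

(** The density vanishes below [t], so a comparison on [[t, +oo[] suffices. Resting on
    [le_integral_lower], it also covers integrands not known to be measurable. *)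
Lemma le_Edens t g f1 f2 : 0 < g -> (forall x, t <= x -> (0 <= f1 x)%E) ->
  (forall x, t <= x -> (f1 x <= f2 x)%E) -> (Edens t g f1 <= Edens t g f2)%E.
Proof.
move=> g0 f1_ge0 f12; apply: le_integral_lower => x; case: (leP t x) => tx.
- by rewrite mule_ge0 ?lee_fin ?dens_ge0 ?f1_ge0.
- by rewrite dens_lt// mul0e.
- by rewrite lee_wpmul2l ?lee_fin ?dens_ge0 ?f12.
- by rewrite dens_lt// !mul0e.
Qed.

Lemma Edens_ge0 t g f : 0 < g -> (forall x, t <= x -> (0 <= f x)%E) ->
  (0 <= Edens t g f)%E.
Proof.
move=> g0 f_ge0; apply: integral_ge0 => x _; case: (leP t x) => tx.
- by rewrite mule_ge0 ?lee_fin ?dens_ge0 ?f_ge0.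
- by rewrite dens_lt// mul0e.
Qed.

Lemma integral_dens t g : 0 < g ->
  (\int[lebesgue_measure]_x (dens t g x)%:E = 1)%E.
Proof.
move=> g0.
set k := expR (t / g) / g; pose F x := - (expR (t / g) * expR (- g^-1 * x)).
have dF x : is_derive x (1:R) F (k * expR (- x / g)).
  rewrite /F; apply: is_derive_eq.
  by rewrite /GRing.scale/= /k !mulr1 [in RHS]mulNr [x / g]mulrC mulNr; ring.
have cF : continuous F.
  by move=> x; apply: differentiable_continuous; apply/derivable1_diffP; exact: ex_derive.
(* The density is integrated over [[t, +oo[] through its primitive [F], which equals -1 at [t] and
   tends to 0 at infinity. *)
rewrite (_ : (\int[_]_x _)%E =
    (\int[lebesgue_measure]_(x in `[t, +oo[) (k * expR (- x / g))%:E)%E).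
  rewrite (@ge0_continuous_FTC2y _ _ F _ 0)//.
  - rewrite sub0e /F -expRD mulNr mulrC subrr expR0.
    by rewrite EFinN oppeK.
  - by move=> x _; rewrite !mulr_ge0 ?expR_ge0 ?invr_ge0 ?ltW.
  - apply: continuous_subspaceT => x.
    apply: differentiable_continuous; apply/derivable1_diffP.
    exact: ex_derive.
  - rewrite -oppr0 -(mulr0 (expR (t / g))); apply: cvgN.
    apply: cvgM; first exact: cvg_cst.
    rewrite (_ : (fun x => expR (- g^-1 * x)) =
               (fun z => expR (- z)) \o (fun z => g^-1 * z)); last first.
      by apply: eq_fun => x; rewrite mulNr.
    apply: (@cvg_comp _ _ _ _ _ _ (pinfty_nbhs R)); last exact: cvgr_expR.
    by apply: gt0_cvgMry => //; rewrite invr_gt0.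
  - by apply: cvg_at_right_filter; exact: cF.
  - by move=> x _; rewrite derive1E derive_val.
rewrite [RHS]integral_mkcond; apply: eq_integral => x _.
by rewrite patchE /dens mem_set_itv in_itv/= andbT; case: ifP.
Qed.

Lemma Edens_cst t g (k : \bar R) : 0 < g -> (0 <= k)%E ->
  Edens t g (fun=> k) = k.
Proof.
move=> g0 k0; rewrite /Edens ge0_integralZr ?integral_dens ?mul1e//.
- by apply/measurable_EFinP; exact: measurable_dens.
- by move=> x _; rewrite lee_fin dens_ge0.
Qed.

Lemma EdensZl t g f (k : \bar R) : 0 < g -> (forall x, 0 <= f x)%E ->
  measurable_fun setT f -> (0 <= k)%E ->
  Edens t g (fun x => k * f x)%E = (k * Edens t g f)%E.
Proof.
move=> g0 f0 mf k0; rewrite /Edens -ge0_integralZl//.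
- by apply: eq_integral => x _; rewrite muleCA.
- apply: emeasurable_funM => //.
  by apply/measurable_EFinP; exact: measurable_dens.
- by move=> x _; rewrite mule_ge0 ?lee_fin ?dens_ge0.
Qed.

Lemma EdensD t g f1 f2 : 0 < g ->
  (forall x, 0 <= f1 x)%E -> measurable_fun setT f1 ->
  (forall x, 0 <= f2 x)%E -> measurable_fun setT f2 ->
  Edens t g (fun x => f1 x + f2 x)%E = (Edens t g f1 + Edens t g f2)%E.
Proof.
move=> g0 f10 mf1 f20 mf2; rewrite /Edens -ge0_integralD//.
- by apply: eq_integral => x _; rewrite ge0_muleDr.
- by move=> x _; rewrite mule_ge0 ?lee_fin ?dens_ge0.
- by apply: emeasurable_funM => //; apply/measurable_EFinP; exact: measurable_dens.
- by move=> x _; rewrite mule_ge0 ?lee_fin ?dens_ge0.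
- by apply: emeasurable_funM => //; apply/measurable_EFinP; exact: measurable_dens.
Qed.

(** On [[t, 1]] the density is at most [expR g^-1 / g] and [x^(-1/2)] has integral at most 2; beyond
    1 the power is at most 1 and the density has total mass 1. The bound is thus free of [t]. *)
Lemma Edens_powRN2_le t g : 0 < g -> 0 < t -> t < 1 ->
  (Edens t g (fun x => (x `^ (- 2^-1))%:E) <= (expR g^-1 / g * 2 + 1)%:E)%E.
Proof.
move=> g0 t0 t1; set k := expR g^-1 / g.
have k0 : 0 <= k by rewrite /k mulr_ge0 ?expR_ge0 ?invr_ge0 ?ltW.
have mp : measurable_fun setT (fun x : R => (x `^ (- 2^-1))%:E).
  by apply/measurable_EFinP; exact: measurable_powR.
have int_le : (\int[lebesgue_measure]_(x in `[t, 1%R]) (x `^ (- 2^-1))%:E <= 2%:E)%E.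
  pose F x : R := 2 * x `^ 2^-1.
  have dF x : 0 < x -> is_derive x (1:R) F (x `^ (- 2^-1)).
    move=> x0; have := is_derive1_powR (2^-1) x0 => ?; apply: is_derive_eq.
    rewrite /GRing.scale/= mulrA mulfV// mul1r.
    by congr (_ `^ _); lra.
  have cF x : 0 < x -> {for x, continuous F}.
    by move=> /dF ?; apply: differentiable_continuous; apply/derivable1_diffP; exact: ex_derive.
  rewrite (@continuous_FTC2 _ _ F)//.
  - rewrite -EFinB lee_fin /F powR1 mulr1 gerBl mulr_ge0//.
    exact: powR_ge0.
  - apply: continuous_in_subspaceT => x; rewrite inE/= in_itv/= => /andP[tx _].
    have x0 : 0 < x by exact: lt_le_trans tx.
    have ? := is_derive1_powR (- 2^-1) x0.
    by apply: differentiable_continuous; apply/derivable1_diffP; exact: ex_derive.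
  - split.
    + move=> x; rewrite in_itv/= => /andP[tx _].
      by have ? := dF x (lt_trans t0 tx); exact: ex_derive.
    + by apply: cvg_at_right_filter; exact: cF.
    + by apply: cvg_at_left_filter; exact: cF.
  - move=> x; rewrite in_itv/= => /andP[tx _].
    by have ? := dF x (lt_trans t0 tx); rewrite derive1E derive_val.
apply: (@le_trans _ _ (\int[lebesgue_measure]_x
   (k%:E * ((fun x => (x `^ (- 2^-1))%:E) \_ `[t, 1%R]) x + (dens t g x)%:E))%E).
  apply: le_integral_lower => x.
    by rewrite -EFinM lee_fin mulr_ge0 ?dens_ge0 ?powR_ge0.
  have d0 := @dens_ge0 t g x g0.
  rewrite patchE mem_set_itv in_itv/=; case: ifPn.
    move=> /andP[tx x1]; rewrite -!EFinM -EFinD lee_fin.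
    rewrite -[leLHS]addr0 lerD// ler_wpM2r ?powR_ge0// /dens tx /k.
    rewrite mulrAC ler_wpM2r ?invr_ge0 ?(ltW g0)// -expRD ler_expR.
    rewrite -mulrDl -[leRHS]mul1r ler_wpM2r ?invr_ge0 ?(ltW g0)//. lra.
  rewrite mule0 add0e -EFinM lee_fin; case: (leP t x) => [tx|xt _].
    rewrite -ltNge => x1; rewrite ler_piMr// powRN.
    have x0 : 0 < x by exact: lt_trans x1.
    (* The constant 1 is displayed as a constant function applied to [2^-1], so that [powR1]
       rewrites it backwards into a power of 1. *)
    rewrite invf_le1 ?powR_gt0// -[leLHS]/((fun=> 1 : R) (2^-1 : R)) -powR1.
    by rewrite ge0_ler_powR ?nnegrE ?(ltW x0) ?(ltW x1).
  by rewrite dens_lt// mul0r.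
have mP : measurable_fun setT ((fun x : R => (x `^ (- 2^-1))%:E) \_ `[t, 1%R]).
  by apply/measurable_restrict => //; apply: measurable_funTS.
rewrite ge0_integralD//=; last 4 first.
- by move=> x _; rewrite mule_ge0 ?lee_fin// patchE; case: ifP => // _; rewrite lee_fin powR_ge0.
- by apply: emeasurable_funM.
- by move=> x _; rewrite lee_fin dens_ge0.
- by apply/measurable_EFinP; exact: measurable_dens.
rewrite integral_dens// ge0_integralZl//; last first.
  by move=> x _; rewrite patchE; case: ifP => // _; rewrite lee_fin powR_ge0.
by rewrite -integral_mkcond EFinD (EFinM k) leeD2r // lee_wpmul2l ?lee_fin.
Qed.

(** On [[u, 1]] the density is at least [expR (- g^-1) / g] and [k / x] integrates to [k * - ln u];
    the other values of [x] contribute a nonnegative amount. *)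
Lemma Edens_inv_ge t g u (k : R) f : 0 < g -> 0 < u -> u < 1 -> t <= u -> 0 < t ->
  0 <= k -> (forall x, t <= x -> (0 <= f x)%E) ->
  (forall x, u <= x <= 1 -> ((k / x)%:E <= f x)%E) ->
  ((expR (- g^-1) / g * k * - ln u)%:E <= Edens t g f)%E.
Proof.
move=> g0 u0 u1 tu t0 k0 f0 fk; set c := expR (- g^-1) / g.
have c0 : 0 <= c by rewrite /c mulr_ge0 ?expR_ge0 ?invr_ge0 ?ltW.
have intE : (\int[lebesgue_measure]_(x in `[u, 1%R]) (x^-1)%:E = (- ln u)%:E)%E.
  have cF x : 0 < x -> {for x, continuous (@ln R)}.
    by move=> /is_derive1_ln ?; apply: differentiable_continuous; apply/derivable1_diffP; exact: ex_derive.
  rewrite (@continuous_FTC2 _ _ (@ln R))//.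
  - by rewrite ln1 sub0e.
  - apply: continuous_in_subspaceT => x; rewrite inE/= in_itv/= => /andP[ux _].
    by apply: inv_continuous; rewrite gt_eqF// (lt_le_trans u0).
  - split.
    + move=> x; rewrite in_itv/= => /andP[ux _].
      by have ? := is_derive1_ln (lt_trans u0 ux); exact: ex_derive.
    + by apply: cvg_at_right_filter; exact: cF.
    + by apply: cvg_at_left_filter; exact: cF.
  - move=> x; rewrite in_itv/= => /andP[ux _].
    by have ? := is_derive1_ln (lt_trans u0 ux); rewrite derive1E derive_val.
rewrite EFinM -intE -ge0_integralZl//; last 3 first.
- apply/measurable_EFinP.
  (* On this interval [x > 0], so inversion agrees with the power of exponent -1, which is
     measurable. *)
  apply: (@eq_measurable_fun _ _ _ _ _ (fun x : R => x `^ (-1))).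
    move=> x; rewrite inE/= in_itv/= => /andP[ux _].
    by rewrite powR_inv1// ltW// (lt_le_trans u0).
  by apply: measurable_funTS; exact: measurable_powR.
- move=> x; rewrite /= in_itv/= => /andP[ux _].
  by rewrite lee_fin invr_ge0 ltW// (lt_le_trans u0).
- by rewrite lee_fin mulr_ge0.
rewrite integral_mkcond; apply: le_integral_lower => x;
    rewrite patchE mem_set_itv in_itv/=.
  case: ifPn => // /andP[ux _].
  by rewrite -EFinM lee_fin !mulr_ge0// invr_ge0 ltW// (lt_le_trans u0).
case: ifPn; last first.
  move=> _; case: (leP t x) => tx; last by rewrite dens_lt// mul0e.
  by rewrite mule_ge0 ?lee_fin ?dens_ge0 ?f0.
move=> uxx; have /andP[ux x1] := uxx.
rewrite -EFinM -mulrA EFinM; apply: lee_pmul.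
- by rewrite lee_fin.
- by rewrite lee_fin mulr_ge0// invr_ge0 ltW// (lt_le_trans u0).
- rewrite lee_fin /dens (le_trans tu ux) /c mulrAC ler_wpM2r ?invr_ge0 ?(ltW g0)//.
  rewrite -expRD ler_expR -mulrDl -[leLHS]mulN1r ler_wpM2r ?invr_ge0 ?(ltW g0)//. lra.
- exact: fk.
Qed.
End density.

(** * Iterated expectations over slots *)

Lemma Edens_measurable d (T : measurableType d) (R : realType) (t g : R)
    (h : T -> R -> \bar R) : 0 < g ->
  (forall x c, (0 <= h x c)%E) -> measurable_fun setT (fun xc : T * R => h xc.1 xc.2) ->
  measurable_fun setT (fun x => Edens t g (h x)).
Proof.
move=> g0 h0 mh.
apply: (measurable_fun_fubini_tonelli_F (m2 := @lebesgue_measure R)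
  (fun xc : T * R => ((dens t g xc.2)%:E * h xc.1 xc.2)%E)).
- apply: emeasurable_funM => //; apply/measurable_EFinP.
  by apply: measurableT_comp => //; exact: measurable_dens.
- by move=> x; rewrite mule_ge0 ?lee_fin ?dens_ge0.
Qed.

Section slots.
Variables (R : realType) (gSR gSD gRD t : R).
Hypotheses (gSR0 : 0 < gSR) (gSD0 : 0 < gSD) (gRD0 : 0 < gRD).
Implicit Types (h : slotT R -> \bar R) (w : nat -> slotT R)
  (f : (nat -> slotT R) -> \bar R).

Local Notation Eslot := (Eslot gSR gSD gRD t).
Local Notation Eiter := (Eiter gSR gSD gRD t).

Definition slot_ge (s : slotT R) : Prop := [/\ t <= s.1.1, t <= s.1.2 & t <= s.2].

Lemma EslotE h : Eslot h = Edens t gSR (fun a => Edens t gSD (fun b =>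
  Edens t gRD (fun c => h ((a, b), c)))).
Proof. by []. Qed.

Lemma le_Eslot h1 h2 : (forall s, slot_ge s -> (0 <= h1 s)%E) ->
  (forall s, slot_ge s -> (h1 s <= h2 s)%E) -> (Eslot h1 <= Eslot h2)%E.
Proof.
move=> h10 h12; rewrite !EslotE.
apply: le_Edens => [//|a ta|a ta].
  by do 2![apply: Edens_ge0 => [//|? ?]]; exact: h10.
apply: le_Edens => [//|b tb|b tb].
  by apply: Edens_ge0 => [//|c tc]; exact: h10.
by apply: le_Edens => [//|c tc|c tc]; [exact: h10|exact: h12].
Qed.

Lemma Eslot_cst (k : \bar R) : (0 <= k)%E -> Eslot (fun=> k) = k.
Proof. by move=> k0; rewrite EslotE !Edens_cst. Qed.

Section measurable_slot.
Variable h : slotT R -> \bar R.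
Hypotheses (h0 : forall s, (0 <= h s)%E) (mh : measurable_fun setT h).

Let mh1 a b : measurable_fun setT (fun c => h ((a, b), c)).
Proof. exact: measurableT_comp. Qed.

Let mh2 : measurable_fun setT (fun ab => Edens t gRD (fun c => h (ab, c))).
Proof.
apply: Edens_measurable => //.
by under eq_fun do rewrite -surjective_pairing.
Qed.

Let mh2' a : measurable_fun setT (fun b => Edens t gRD (fun c => h ((a, b), c))).
Proof. by apply: (measurableT_comp mh2); exact: measurable_pair1. Qed.

Let mh3 : measurable_fun setT
  (fun a => Edens t gSD (fun b => Edens t gRD (fun c => h ((a, b), c)))).
Proof.
apply: Edens_measurable => // [a b|]; first by apply: Edens_ge0.
by under eq_fun do rewrite -surjective_pairing.
Qed.

(** A triple of proofs, one for each level of the three nested integrals, to be destructured by the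
    linearity lemmas. *)
Definition Eslot_measurability :=
  (mh1, mh2', mh3).
End measurable_slot.

Lemma EslotD h1 h2 :
  (forall s, (0 <= h1 s)%E) -> measurable_fun setT h1 ->
  (forall s, (0 <= h2 s)%E) -> measurable_fun setT h2 ->
  Eslot (fun s => h1 s + h2 s)%E = (Eslot h1 + Eslot h2)%E.
Proof.
move=> h10 mh1 h20 mh2; have [[m1 m1'] m1''] := Eslot_measurability h10 mh1.
have [[m2 m2'] m2''] := Eslot_measurability h20 mh2.
have inner_ge0 h : (forall s, (0 <= h s)%E) -> forall a b,
    (0 <= Edens t gRD (fun c => h ((a, b), c)))%E.
  by move=> h0 a b; apply: Edens_ge0.
have outer_ge0 h : (forall s, (0 <= h s)%E) -> forall a,
    (0 <= Edens t gSD (fun b => Edens t gRD (fun c => h ((a, b), c))))%E.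
  by move=> h0 a; apply: Edens_ge0 => // b _; exact: inner_ge0.
rewrite !EslotE -EdensD; [|by []|exact: outer_ge0|exact: m1''|exact: outer_ge0|exact: m2''].
congr Edens; apply/funext => a.
rewrite -EdensD; [|by []|exact: inner_ge0|exact: m1'|exact: inner_ge0|exact: m2'].
by congr Edens; apply/funext => b; rewrite -EdensD.
Qed.

Lemma EslotZl h (k : \bar R) : (forall s, (0 <= h s)%E) -> measurable_fun setT h ->
  (0 <= k)%E -> Eslot (fun s => k * h s)%E = (k * Eslot h)%E.
Proof.
move=> h0 mh k0; have [[m1 m2] m3] := Eslot_measurability h0 mh.
rewrite !EslotE -EdensZl//; last first.
  by move=> a; do 2!apply: Edens_ge0 => // ? ?.
congr Edens; apply/funext => a; rewrite -EdensZl//; last first.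
  by move=> b; apply: Edens_ge0.
by congr Edens; apply/funext => b; rewrite -EdensZl.
Qed.

(** These sequences carry the mass of [Eiter n j] started at [w]; almost sure properties enter the
    proof as properties of all of them. *)
Definition reach n j w w' : Prop :=
  forall i, if (j <= i < j + n)%N then slot_ge (w' i) else w' i = w i.

Lemma reach_upd n j w w' s : slot_ge s -> reach n j.+1 (upd w j s) w' ->
  reach n.+1 j w w'.
Proof.
move=> sge rw i; have := rw i; rewrite /upd addSnnS.
have [->|ij] := eqVneq i j; first by rewrite ltnn leqnn -addSnnS leq_addr/= => ->.
by rewrite [(j <= i)%N]leq_eqVlt eq_sym (negPf ij).
Qed.

(** Both conclusions go through one induction, because [le_Eslot] asks that the smaller integrand,
    itself an iterated expectation, be nonnegative. *)
Lemma le_Eiter n j f1 f2 w : (forall w', reach n j w w' -> (0 <= f1 w')%E) ->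
  (forall w', reach n j w w' -> (f1 w' <= f2 w')%E) ->
  (Eiter n j f1 w <= Eiter n j f2 w)%E /\ (0 <= Eiter n j f1 w)%E.
Proof.
elim: n j w => [|n IH] j w /= f10 f12.
  by split; [apply: f12|apply: f10] => i; rewrite addn0 leqNgt andNb.
have {}IH s : slot_ge s -> (Eiter n j.+1 f1 (upd w j s) <= Eiter n j.+1 f2 (upd w j s))%E
    /\ (0 <= Eiter n j.+1 f1 (upd w j s))%E.
  by move=> sge; apply: IH => w' /(reach_upd sge); [exact: f10|exact: f12].
split; first by apply: le_Eslot => s /IH[].
rewrite -(Eslot_cst (lexx 0%E)); apply: le_Eslot => // s /IH[]//.
Qed.

Lemma Eiter_cst n j (k : \bar R) w : (0 <= k)%E -> Eiter n j (fun=> k) w = k.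
Proof.
move=> k0; elim: n j w => //= n IH j w.
rewrite -[RHS](Eslot_cst k0); congr (Defs.Eslot _ _ _ _ _).
by apply/funext => s; rewrite IH.
Qed.

Lemma Eiter_ge n j f w (k : \bar R) : (0 <= k)%E ->
  (forall w', reach n j w w' -> (k <= f w')%E) -> (k <= Eiter n j f w)%E.
Proof.
by move=> k0 kf; rewrite -(Eiter_cst n j w k0); apply: (le_Eiter _ kf).1.
Qed.

Lemma Eiter_le n j f w (k : \bar R) : (forall w', reach n j w w' -> (0 <= f w')%E) ->
  (forall w', reach n j w w' -> (f w' <= k)%E) -> (0 <= k)%E ->
  (Eiter n j f w <= k)%E.
Proof.
by move=> f0 fk k0; rewrite -(Eiter_cst n j w k0); apply: (le_Eiter f0 fk).1.
Qed.

(* Sequences of slots carry no sigma-algebra here, so measurability is tested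
   along all coordinatewise measurable parametrisations. *)
Definition seq_measurable (f : (nat -> slotT R) -> \bar R) : Prop :=
  (forall w, 0 <= f w)%E /\
  forall d (T : measurableType d) (phi : T -> nat -> slotT R),
    (forall i, measurable_fun setT (fun x => phi x i)) ->
    measurable_fun setT (fun x => f (phi x)).
End slots.

Section seq_measurable.
Variables (R : realType) (gSR gSD gRD t : R).
Hypotheses (gSR0 : 0 < gSR) (gSD0 : 0 < gSD) (gRD0 : 0 < gRD).
Implicit Types (w : nat -> slotT R) (f : (nat -> slotT R) -> \bar R).
Local Notation Eiter := (Eiter gSR gSD gRD t).

Lemma measurable_upd d (T : measurableType d) (phi : T -> nat -> slotT R)
    (s : T -> slotT R) j :
  (forall i, measurable_fun setT (fun x => phi x i)) -> measurable_fun setT s ->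
  forall i, measurable_fun setT (fun x => upd (phi x) j (s x) i).
Proof. by move=> mphi ms i; rewrite /upd; case: eqP. Qed.

(** The parameter space is enlarged by the three SNRs of slot [j], which are then integrated out one
    at a time by Tonelli. Since [seq_measurable] quantifies over all parameter spaces, the induction
    hypothesis applies on the enlarged one. *)
Lemma seq_measurable_Eiter n j f : seq_measurable f -> seq_measurable (Eiter n j f).
Proof.
move=> [f0 mf]; elim: n j => [//|n IH] j; have [e0 me] := IH j.+1.
split=> [w|d T phi mphi] /=.
  by rewrite EslotE; do 3!apply: Edens_ge0 => // ? ?.
under eq_fun do rewrite EslotE.
apply: Edens_measurable => // [x a|]; first by do 2!apply: Edens_ge0 => // ? ?.
apply: (@Edens_measurable _ _ _ _ _ (fun (xa : T * R) b => Edens t gRD (fun c =>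
  Eiter n j.+1 f (upd (phi xa.1) j (xa.2, b, c))))) => // [x b|].
  by apply: Edens_ge0 => // ? ?.
apply: (@Edens_measurable _ _ _ _ _ (fun (xab : T * R * R) c =>
  Eiter n j.+1 f (upd (phi xab.1.1) j (xab.1.2, xab.2, c)))) => //.
apply: me; apply: measurable_upd => [i|].
  apply: (measurableT_comp (mphi i)).
  by do 2!apply: measurableT_comp => //.
apply: measurable_fun_pair => //; apply: measurable_fun_pair => //.
  by do 2!apply: measurableT_comp => //.
by apply: measurableT_comp.
Qed.

Let measurable_slice n j f w : seq_measurable f ->
  measurable_fun setT (fun s => Eiter n j.+1 f (upd w j s)).
Proof.
by move=> /(seq_measurable_Eiter n j.+1)[_]; apply; exact: measurable_upd.
Qed.

Let Eiter_ge0 n j f w : seq_measurable f -> (0 <= Eiter n j f w)%E.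
Proof. by move=> /(seq_measurable_Eiter n j)[]. Qed.

Lemma EiterD n j f1 f2 w : seq_measurable f1 -> seq_measurable f2 ->
  Eiter n j (fun w => f1 w + f2 w)%E w = (Eiter n j f1 w + Eiter n j f2 w)%E.
Proof.
move=> mf1 mf2; elim: n j w => [//|n IH] j w /=.
under eq_fun do rewrite IH.
by rewrite EslotD// => *; (exact: Eiter_ge0 || exact: measurable_slice).
Qed.

Lemma EiterZl n j f k w : seq_measurable f -> (0 <= k)%E ->
  Eiter n j (fun w => k * f w)%E w = (k * Eiter n j f w)%E.
Proof.
move=> mf k0; elim: n j w => [//|n IH] j w /=.
under eq_fun do rewrite IH.
by rewrite EslotZl// => *; (exact: Eiter_ge0 || exact: measurable_slice).
Qed.
End seq_measurable.

(** * State, cost and outage without relaying *)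

Section norelay.
Variables (R : realType) (B : R) (p : policy R).
Arguments p : clear implicits.
Hypotheses (B0 : 0 < B) (p0 : forall k h, 0 <= p k h)
  (mp : forall k, measurable_fun setT (p k)).
Implicit Types (w : nat -> slotT R).
Local Notation pow := (fun w k => p k (hist (@norelay_obs R \o w) k)).

(** The observed source-relay SNR is 0, so the relay's deficit stays at [B > 0] and Phase 2 never
    starts. *)
Lemma bstate_norelay w k : bstate (@norelay_obs R) B p w k =
  (B, B - \sum_(i < k) Icap (pow w i * (w i).1.2)).
Proof.
elim: k => [|k IH] /=; first by rewrite big_ord0 subr0.
rewrite IH /step /= B0 /gSRof /gSDof /= mulr0 /Icap addr0 ln1 subr0.
by rewrite big_ord_recr/= opprD addrA.
Qed.

Lemma norelay_power_causal w w' k : (forall i, (i <= k)%N -> w i = w' i) ->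
  pow w k = pow w' k.
Proof.
move=> ww'; congr p; apply: eq_from_tnth => i; rewrite !tnth_mktuple /=.
by rewrite ww'// -ltnS.
Qed.

Section measurability.
Context d (T : measurableType d) (phi : T -> nat -> slotT R).
Hypothesis mphi : forall i, measurable_fun setT (fun x => phi x i).

Lemma measurable_norelay_power k : measurable_fun setT (fun x => pow (phi x) k).
Proof.
apply: (measurableT_comp (@mp k)
  (g := fun x => hist (@norelay_obs R \o phi x) k)); apply/measurable_fun_tnthP => i.
rewrite (_ : _ \o _ = (fun x => norelay_obs (phi x i))); last first.
  by apply/funext => x /=; rewrite tnth_mktuple.
rewrite /norelay_obs; apply: measurable_fun_pair; last exact: measurableT_comp.
by apply: measurable_fun_pair => //; do 2!apply: measurableT_comp => //.
Qed.

Lemma measurable_norelay_state K :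
  measurable_fun setT (fun x => (bstate (@norelay_obs R) B p (phi x) K).2).
Proof.
under eq_fun do rewrite bstate_norelay/=.
apply: measurable_funB => //; apply: measurable_sum => i.
rewrite /Icap; apply: measurableT_comp; first exact: measurable_ln.
apply: measurable_funD => //; apply: measurable_funM; first exact: measurable_norelay_power.
by do 2!apply: measurableT_comp => //.
Qed.
End measurability.

Definition cost K w : \bar R := (\sum_(k < K) pow w k)%:E.
Definition outage K w : \bar R :=
  if (bstate (@norelay_obs R) B p w K).2 <= 0 then 0%E else 1%E.

Lemma seq_measurable_cost K : seq_measurable (cost K).
Proof.
split=> [w|d T phi mphi]; first by rewrite lee_fin sumr_ge0.
apply/measurable_EFinP; apply: measurable_sum => i; exact: measurable_norelay_power.
Qed.

Lemma seq_measurable_outage K : seq_measurable (outage K).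
Proof.
split=> [w|d T phi mphi]; first by rewrite /outage; case: ifP.
apply: measurable_fun_ifT => //; apply: measurable_fun_ler => //.
exact: measurable_norelay_state.
Qed.
End norelay.

(** * Divergence without relaying *)

Section lower_bound.
Variables (R : realType) (gSR gSD gRD : R).
Hypotheses (gSR0 : 0 < gSR) (gSD0 : 0 < gSD) (gRD0 : 0 < gRD).
Implicit Types (w : nat -> slotT R) (t B : R) (p : policy R).

(** The cap [C * expR L] is the value of [C / x] at [x = expR (- L)]. Hence the minimum is [C / x]
    on [[expR (- L), 1]], over which [1 / x] integrates to [L]. *)
Lemma Eslot_min_ge t (C L : R) (h : slotT R -> \bar R) :
  0 < t -> t <= expR (- L) -> 0 < L -> 0 <= C ->
  (forall s, slot_ge t s -> ((Num.min (C / s.1.2) (C * expR L))%:E <= h s)%E) ->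
  ((expR (- gSD^-1) / gSD * C * L)%:E <= Eslot gSR gSD gRD t h)%E.
Proof.
move=> t0 tL L0 C0 hge; set k := (X in (X%:E <= _)%E).
have k0 : (0 <= k%:E)%E.
  by rewrite lee_fin /k !mulr_ge0 ?expR_ge0 ?invr_ge0 ?(ltW gSD0) ?(ltW L0).
have h0 s : slot_ge t s -> (0 <= h s)%E.
  move=> sge; apply: le_trans (hge _ sge); rewrite lee_fin le_min.
  by rewrite divr_ge0 ?mulr_ge0 ?expR_ge0//; case: sge => _ /(lt_le_trans t0)/ltW.
rewrite EslotE -(Edens_cst t gSR0 k0); apply: le_Edens => [|_ _|a ta]; [exact: gSR0|exact: k0|].
have -> : k = expR (- gSD^-1) / gSD * C * - ln (expR (- L)) by rewrite expRK opprK.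
apply: Edens_inv_ge; [by []|exact: expR_gt0|by rewrite expR_lt1 oppr_lt0|by []..| |].
  by move=> b tb; apply: Edens_ge0 => // c tc; exact: h0.
move=> b /andP[Lb b1]; have tb := le_trans tL Lb.
have b0 := lt_le_trans t0 tb.
have Cb : (0 <= (C / b)%:E)%E by rewrite lee_fin divr_ge0// ltW.
rewrite -(Edens_cst t gRD0 Cb); apply: le_Edens => [|_ _|c tc]; [exact: gRD0|exact: Cb|].
apply: le_trans (hge _ _); last by []; rewrite lee_fin le_min lexx/= ler_wpM2l//.
by rewrite -[leRHS]invrK -expRN lef_pV2// posrE ?expR_gt0.
Qed.

(** The state of index [k] is the one before slot [k], hence the strict bound; the power of slot [k]
    also sees slot [k] itself. *)
Lemma bstate_causal (obs : slotT R -> slotT R) B p w w' k : (forall i, (i < k)%N -> w i = w' i) ->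
  bstate obs B p w k = bstate obs B p w' k.
Proof.
elim: k => // k IH ww' /=; rewrite IH => [|i ik]; last by apply: ww'; exact: leqW.
rewrite (ww' k)//; congr (step _ _ (p k _)).
by apply: eq_from_tnth => i; rewrite !tnth_mktuple /= ww'.
Qed.

(** Since [+oo * 0 = 0], this is the plain cost where the message is delivered and [+oo] elsewhere.
    The almost sure constraint thereby becomes part of an objective that can be bounded slot by
    slot. *)
Definition penalised_cost B p K w : \bar R := (cost p K w + +oo * outage B p K w)%E.

(** By linearity the penalty contributes [+oo] times the expected outage, and that product is 0. *)
Lemma Eiter_penalised_cost t B p K n j w : 0 < B -> (forall k h, 0 <= p k h) ->
  (forall k, measurable_fun setT (p k)) ->
  Eiter gSR gSD gRD t n j (outage B p K) w = 0%E ->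
  Eiter gSR gSD gRD t n j (penalised_cost B p K) w =
  Eiter gSR gSD gRD t n j (cost p K) w.
Proof.
move=> B0 p0 mp out0.
have [f0 mf] := seq_measurable_outage B0 mp K.
rewrite /penalised_cost EiterD//.
- by rewrite EiterZl// ?out0 ?mule0 ?adde0//; exact: seq_measurable_outage.
- exact: seq_measurable_cost.
- split=> [w'|d T phi mphi]; first by rewrite mule_ge0.
  by apply: emeasurable_funM => //; exact: mf.
Qed.

(* Either this slot delivers b/2 nats, at a power of at least
   (e^(b/2) - 1)/gamma, or more than b/2 nats are left to the next slots. *)
Lemma penalised_cost_slot t B p K n j w b A s :
  0 < t -> 0 < B -> (forall k h, 0 <= p k h) -> (j < K)%N -> 0 < b ->
  (forall w', b / 2 <= (bstate (@norelay_obs R) B p w' j.+1).2 ->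
    (A%:E <= Eiter gSR gSD gRD t n j.+1 (penalised_cost B p K) w')%E) ->
  b <= (bstate (@norelay_obs R) B p w j).2 -> slot_ge t s ->
  ((Num.min ((expR (b / 2) - 1) / s.1.2) A)%:E <=
    Eiter gSR gSD gRD t n j.+1 (penalised_cost B p K) (upd w j s))%E.
Proof.
move=> t0 B0 p0 jK b0 IH remb sge; set w1 := upd w j s.
have s0 : 0 < s.1.2 by case: sge => _ /(lt_le_trans t0).
pose P := p j (hist (@norelay_obs R \o w1) j).
have [delivered|] := leP (b / 2) (Icap (P * s.1.2)); last first.
  move=> delivered; apply: (@le_trans _ _ A%:E).
    by rewrite lee_fin ge_min lexx orbT.
  apply: IH; rewrite bstate_norelay//= big_ord_recr/= opprD addrA.
  have := remb; rewrite (@bstate_causal _ _ _ w w1) => [|i ij]; last first.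
    by rewrite /w1 /upd ltn_eqF.
  rewrite bstate_norelay//= => remb'.
  have -> : w1 j = s by rewrite /w1 /upd eqxx.
  rewrite -/P; lra.
apply: (@le_trans _ _ P%:E).
  rewrite lee_fin ge_min ler_pdivrMr//; apply/orP; left.
  have Ps : 0 <= P * s.1.2 by exact: mulr_ge0 (p0 _ _) (ltW s0).
  rewrite lerBlDl -[leRHS]lnK ?ler_expR// posrE; lra.
(* The power of slot [j] depends on slots up to [j] only, so [P] bounds the total cost from below
   along every continuation [w']. *)
apply: Eiter_ge => //; first by rewrite lee_fin /P p0.
move=> w' rw'; apply: (@le_trans _ _ (cost p K w')).
  rewrite /cost lee_fin (bigD1 (Ordinal jK))//=.
  rewrite (@norelay_power_causal _ _ w' w1) ?lerDl ?sumr_ge0// => i ij.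
  by have := rw' i; rewrite leqNgt ltnS ij.
by rewrite /penalised_cost leeDl// mule_ge0// /outage; case: ifP.
Qed.

(** The threshold [d] is chosen before [B], the policy, the position [j] and the past [w]. This
    uniformity lets the induction hypothesis follow an arbitrary current slot, and the bound survive
    the infimum over policies. *)
Lemma penalised_cost_diverges n (b A : R) : 0 < b -> exists2 d, 0 < d &
  forall t B p j w, 0 < t -> t < d -> 0 < B -> (forall k h, 0 <= p k h) ->
    b <= (bstate (@norelay_obs R) B p w j).2 ->
    (A%:E <= Eiter gSR gSD gRD t n j (penalised_cost B p (j + n)) w)%E.
Proof.
elim: n b A => [|n IH] b A b0.
  (* No slot is left and a positive amount remains, so there is an outage and the penalised cost is
     [+oo]. *)
  exists 1 => // t B p j w _ _ B0 p0 remb /=; rewrite addn0.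
  rewrite /penalised_cost /outage.
  have := lt_le_trans b0 remb; rewrite ltNge => /negbTE ->; rewrite mule1.
  by rewrite addey ?leey// /cost.
have b20 : 0 < b / 2 by rewrite divr_gt0.
have C0 : 0 < expR (b / 2) - 1 by rewrite subr_gt0 expR_gt1.
set C := expR (b / 2) - 1 in C0.
pose k := expR (- gSD^-1) / gSD * C.
have k0 : 0 < k by rewrite /k !mulr_gt0 ?invr_gt0 ?expR_gt0.
(* This [L] gives [k * L >= A], and the 1 keeps it positive. The later slots are then asked for
   [C * expR L], the cap in [Eslot_min_ge]. *)
pose L := Num.max 1 (A / k).
have L0 : 0 < L by rewrite lt_max ltr01.
have [d d0 Hd] := IH (b / 2) (C * expR L) b20.
exists (Num.min d (expR (- L))); first by rewrite lt_min d0 expR_gt0.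
move=> t B p j w t0; rewrite lt_min => /andP[td tL] B0 p0 remb /=.
apply: (@le_trans _ _ (k * L)%:E).
  by rewrite lee_fin mulrC -ler_pdivrMr// le_max lexx orbT.
apply: Eslot_min_ge => //; [exact: ltW|exact: ltW|] => s sge.
apply: penalised_cost_slot => //; first by rewrite addnS ltnS leq_addr.
by move=> w' rw'; rewrite addnS -addSn; exact: Hd.
Qed.

(** Slot 0 is treated apart because [Jstar] is conditional on it: every policy is bounded below for
    a fixed first slot, then the infimum is taken, and only then is slot 0 averaged. *)
Lemma NMESE_norelay_diverges Reff K : 0 < Reff -> (0 < K)%N ->
  NMESE (@norelay_obs R) K Reff gSR gSD gRD gtr @[gtr --> 0^'+] --> +oo%E.
Proof.
case: K => // n Reff0 _; apply/cvgeyPge => A.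
set B := n.+1%:R * Reff; have B0 : 0 < B by rewrite mulr_gt0.
have B20 : 0 < B / 2 by rewrite divr_gt0.
have C0 : 0 < expR (B / 2) - 1 by rewrite subr_gt0 expR_gt1.
set C := expR (B / 2) - 1 in C0.
pose k := expR (- gSD^-1) / gSD * C.
have k0 : 0 < k by rewrite /k !mulr_gt0 ?invr_gt0 ?expR_gt0.
(* The factor [n.+1%:R] makes up for the normalisation by the number of slots. *)
pose L := Num.max 1 (n.+1%:R * A / k).
have L0 : 0 < L by rewrite lt_max ltr01.
have [d d0 Hd] := penalised_cost_diverges n (C * expR L) B20.
near=> t.
have t0 : 0 < t by near: t; exact: nbhs_right_gt.
have td : t < d by near: t; exact: nbhs_right_lt.
have tL : t < expR (- L) by near: t; apply: nbhs_right_lt; exact: expR_gt0.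
rewrite /NMESE -/B; apply: (@le_trans _ _ ((n.+1%:R)^-1%:E * (k * L)%:E)%E).
  rewrite -EFinM lee_fin ler_pdivlMl// mulrC -[leRHS]mulrC -ler_pdivrMr//.
  by rewrite le_max mulrC lexx orbT.
rewrite lee_wpmul2l ?lee_fin//; apply: Eslot_min_ge => //; [exact: ltW|exact: ltW|] => s sge.
apply: le_ereal_inf_tmp => _ [p [mp [p0 out0]] <-] /=.
rewrite -[leRHS](@Eiter_penalised_cost _ B p n.+1)//.
(* The constant sequence is written as an update at slot 0 to fit [penalised_cost_slot]. *)
rewrite (_ : (fun=> s) = upd (fun=> s) 0 s); last first.
  by apply/funext => i; rewrite /upd; case: ifP.
apply: penalised_cost_slot => //.
by move=> w' rw'; rewrite -add1n; exact: Hd.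
Unshelve. all: by end_near. Qed.
End lower_bound.

(** * Boundedness with relaying *)

Section upper_bound.
Variables (R : realType) (gSR gSD gRD : R).
Hypotheses (gSR0 : 0 < gSR) (gSD0 : 0 < gSD) (gRD0 : 0 < gRD).
Implicit Types (w : nat -> slotT R) (t B C : R) (s : slotT R).

(** Not the moment of order -1/2 itself, but the bound on it from [Edens_powRN2_le], common to all
    thresholds in []0, 1[]. *)
Definition invsqrt_moment (g : R) : R := expR g^-1 / g * 2 + 1.

Lemma invsqrt_moment_ge0 g : 0 < g -> 0 <= invsqrt_moment g.
Proof. by move=> g0; rewrite /invsqrt_moment addr_ge0// !mulr_ge0 ?expR_ge0 ?invr_ge0 ?(ltW g0). Qed.

Lemma Edens_affine_le t g (k r : R) : 0 < g -> 0 < t -> t < 1 -> 0 <= k -> 0 <= r ->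
  (Edens t g (fun x => (k + r * x `^ (- 2^-1))%:E) <= (k + r * invsqrt_moment g)%:E)%E.
Proof.
move=> g0 t0 t1 k0 r0.
have mp : measurable_fun setT (fun x : R => (x `^ (- 2^-1))%:E).
  by apply/measurable_EFinP; exact: measurable_powR.
under [X in Edens t g X]eq_fun do rewrite EFinD EFinM.
rewrite EdensD//; last 2 first.
- by move=> x; rewrite mule_ge0 ?lee_fin// powR_ge0.
- exact: emeasurable_funM.
rewrite Edens_cst// EdensZl//; last by move=> x; rewrite lee_fin powR_ge0.
by rewrite EFinD EFinM leeD2l// lee_wpmul2l ?lee_fin// Edens_powRN2_le.
Qed.

(** Both square roots are at most that of [m]: the larger of two SNRs dominates their geometric
    mean. *)
Lemma powRN2_mul_ge1 (x y m : R) : 0 < x -> 0 < y -> x <= m -> y <= m ->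
  1 <= x `^ (- 2^-1) * y `^ (- 2^-1) * m.
Proof.
move=> x0 y0 xm ym; have m0 : 0 < m by exact: lt_le_trans xm.
have half (z : R) : 0 < z -> z <= m -> 1 <= z `^ (- 2^-1) * m `^ (2^-1).
  move=> z0 zm; rewrite powRN mulrC ler_pdivlMr ?powR_gt0// mul1r.
  by rewrite ge0_ler_powR ?nnegrE ?(ltW z0) ?(ltW m0).
have mE : m = m `^ 2^-1 * m `^ 2^-1.
  rewrite -powRD; last by rewrite gt_eqF ?implybT.
  by rewrite (_ : _ + _ = 1) ?powRr1 ?(ltW m0)//; lra.
rewrite [in leRHS]mE mulrACA -[leLHS]mulr1; apply: ler_pM => //; exact: half.
Qed.

(* The source and the relay each spend the full B nats in one slot: slot 0 is
   decoded by the relay or by the destination, slot 1 forwards if needed.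
   Replacing the maximum of two SNRs by their geometric mean decouples the
   links in the expected cost. *)
Definition slot_power C (k : nat) s : R :=
  if k == 0%N then C * s.1.1 `^ (- 2^-1) * s.1.2 `^ (- 2^-1)
  else if k == 1%N then C * s.1.2 `^ (- 2^-1) * s.2 `^ (- 2^-1) else 0.

Definition two_slot_policy C : policy R :=
  fun k h => slot_power C k (tnth h ord_max).

Lemma slot_power_ge0 C k s : 0 <= C -> 0 <= slot_power C k s.
Proof.
by move=> C0; rewrite /slot_power; do 2?case: ifP => // _; rewrite !mulr_ge0 ?powR_ge0.
Qed.

Lemma two_slot_policyE C w k :
  two_slot_policy C (hist (@relay_obs R \o w) k) = slot_power C k (w k).
Proof. by rewrite /two_slot_policy tnth_mktuple. Qed.

Lemma measurable_two_slot_policy C k : measurable_fun setT (@two_slot_policy C k).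
Proof.
apply: (measurableT_comp (f := slot_power C k) (g := fun h => tnth h ord_max));
  last exact: measurable_tnth.
have mpow (u v : slotT R -> R) : measurable_fun setT u -> measurable_fun setT v ->
    measurable_fun setT (fun s => C * u s `^ (- 2^-1) * v s `^ (- 2^-1)).
  move=> mu mv; apply: measurable_funM; first apply: measurable_funM => //.
    exact: (measurableT_comp (@measurable_powR R (- 2^-1)) mu).
  exact: (measurableT_comp (@measurable_powR R (- 2^-1)) mv).
case: k => [|[|k]]; rewrite /slot_power//=.
- by apply: mpow; exact: measurableT_comp.
- by apply: mpow => //; exact: measurableT_comp.
Qed.

Lemma Icap_ge0 (x : R) : 0 <= x -> 0 <= Icap x.
Proof. by move=> x0; rewrite /Icap ln_ge0// lerDl. Qed.

(** A received SNR of [expR B - 1] carries exactly [B] nats, and by [powRN2_mul_ge1] the power used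
    here reaches it on a link of SNR [m]. *)
Lemma Icap_full B (x y m : R) : 0 < B -> 0 < x -> 0 < y -> x <= m -> y <= m ->
  B <= Icap ((expR B - 1) * x `^ (- 2^-1) * y `^ (- 2^-1) * m).
Proof.
move=> B0 x0 y0 xm ym; have h := powRN2_mul_ge1 x0 y0 xm ym.
have C0 : 0 <= expR B - 1 by rewrite ltW ?subr_gt0 ?expR_gt1.
rewrite /Icap -[leLHS]expRK ler_ln ?posrE ?expR_gt0//; last first.
  by rewrite ltr_wpDr// !mulr_ge0 ?powR_ge0// (le_trans (ltW x0)).
by rewrite -lerBlDl -[leLHS]mulr1 -!mulrA ler_wpM2l// mulrA.
Qed.

Lemma step_snd_le t b s (x : R) : 0 < t -> slot_ge t s -> 0 <= x ->
  (step b s x).2 <= b.2.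
Proof.
move=> t0 [_ tb tc] x0; have sb : 0 <= s.1.2 by rewrite (le_trans (ltW t0)).
rewrite /step; case: ifP => _ /=; rewrite gerBl Icap_ge0// mulr_ge0//.
by rewrite le_max /gSDof sb.
Qed.

(** In slot 0 the better of the two links from the source carries all [B] nats. If it leads to the
    relay, slot 1 falls in Phase 2 and the better link to the destination carries [B] nats;
    otherwise the destination is already served. *)
Lemma two_slot_policy_delivers t B w n : 0 < t -> 0 < B ->
  (forall i, (i < n.+2)%N -> slot_ge t (w i)) ->
  (bstate (@relay_obs R) B (two_slot_policy (expR B - 1)) w n.+2).2 <= 0.
Proof.
move=> t0 B0 wge; set p := two_slot_policy _.
have C0 : 0 <= expR B - 1 by rewrite ltW ?subr_gt0 ?expR_gt1.
(* Slots after the first two cannot raise the destination's deficit, which leaves the case of two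
   slots. *)
elim: n wge => [|n IH] wge; last first.
  apply: le_trans (IH _); last by move=> i /leqW; exact: wge.
  apply: (step_snd_le _ t0); first exact: wge.
  exact: slot_power_ge0.
have [w0a w0b _] : slot_ge t (w 0%N) by exact: wge.
have w1ge : slot_ge t (w 1%N) by exact: wge.
have [_ w1b w1c] := w1ge.
have pos x : t <= x -> 0 < x := lt_le_trans t0.
have -> : bstate (@relay_obs R) B p w 2 =
    step (B - Icap (slot_power (expR B - 1) 0 (w 0%N) * (w 0%N).1.1),
          B - Icap (slot_power (expR B - 1) 0 (w 0%N) * (w 0%N).1.2))
      (w 1%N) (slot_power (expR B - 1) 1 (w 1%N)).
  by rewrite /= /p !two_slot_policyE {2}/step /= B0.
set sp0 := slot_power _ 0 _; set sp1 := slot_power _ 1 _.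
have sp1_ge0 : 0 <= sp1 by exact: slot_power_ge0.
have [ba|ab] := leP (w 0%N).1.2 (w 0%N).1.1.
  have := Icap_full B0 (pos _ w0a) (pos _ w0b) (lexx _) ba.
  rewrite -/(slot_power _ 0 _) -/sp0 -subr_le0 => bR; rewrite /step /= ltNge bR /=.
  have : 0 <= Icap (sp0 * (w 0%N).1.2).
    by rewrite Icap_ge0// mulr_ge0 ?slot_power_ge0// ltW// pos.
  have : B <= Icap (sp1 * Num.max (gSDof (w 1%N)) (gRDof (w 1%N))).
    apply: Icap_full => //; [exact: pos|exact: pos|by rewrite le_max lexx|].
    by rewrite le_max lexx orbT.
  lra.
(* The destination has everything after slot 0; slot 1 can only lower its deficit, in either
   phase. *)
apply: le_trans (step_snd_le _ t0 w1ge sp1_ge0) _ => /=.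
rewrite subr_le0; exact: Icap_full B0 (pos _ w0a) (pos _ w0b) (ltW ab) (lexx _).
Qed.

(** The two-slot policy competes in the infimum. Given the first slot [s], its first power is a
    known number and is kept; its second power averages, by independence of the links, to at most a
    product of two moment bounds. *)
Lemma Jstar_relay_le t B n s : 0 < t -> t < 1 -> 0 < B -> slot_ge t s ->
  (Jstar (@relay_obs R) n.+2 B gSR gSD gRD t s <=
   ((expR B - 1) * invsqrt_moment gSD * invsqrt_moment gRD
     + (expR B - 1) * s.1.1 `^ (- 2^-1) * s.1.2 `^ (- 2^-1))%:E)%E.
Proof.
move=> t0 t1 B0 sge; set C := expR B - 1; pose p := two_slot_policy C.
have C0 : 0 <= C by rewrite /C ltW ?subr_gt0 ?expR_gt1.
have pge0 k h : 0 <= p k h by exact: slot_power_ge0.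
have cost_ge0 w : (0 <= (\sum_(k < n.+2) p k (hist (@relay_obs R \o w) k))%:E)%E.
  by rewrite lee_fin sumr_ge0.
pose q := C * s.1.1 `^ (- 2^-1) * s.1.2 `^ (- 2^-1).
have q0 : 0 <= q by rewrite !mulr_ge0 ?powR_ge0.
apply: (@le_trans _ _ (Eiter gSR gSD gRD t n.+1 1
    (fun w => (\sum_(k < n.+2) p k (hist (@relay_obs R \o w) k))%:E) (fun=> s))).
  apply: ereal_inf_lbound; exists p => //; split; last split => //.
    by move=> k; exact: measurable_two_slot_policy.
  (* Delivery holds along every reachable sequence, which makes the expected outage 0. *)
  have out0 w : reach t n.+1 1 (fun=> s) w ->
      (bstate (@relay_obs R) B p w n.+2).2 <= 0.
    move=> rw; apply: (two_slot_policy_delivers t0) => // i ik; have := rw i.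
    by case: i ik => [_ /= ->|i ik] //; rewrite add1n /= ik.
  apply/eqP; rewrite eq_le; apply/andP; split.
    by apply: Eiter_le => // w /out0 ->.
  by apply: Eiter_ge => // w /out0 ->.
apply: (@le_trans _ _ (Defs.Eslot gSR gSD gRD t (fun s1 => (q + C * s1.1.2 `^ (- 2^-1) * s1.2 `^ (- 2^-1))%:E))).
  rewrite /=; apply: le_Eslot => // s1 s1ge; first exact: Eiter_ge.
  apply: Eiter_le => //; last first.
    by rewrite lee_fin addr_ge0// !mulr_ge0 ?powR_ge0.
  move=> w rw; rewrite lee_fin big_ord_recl big_ord_recl big1 => [|i _].
    rewrite addr0 /p !two_slot_policyE /slot_power /=.
    by have := rw 0%N; have := rw 1%N; rewrite /upd/= => -> ->.
  by rewrite /p two_slot_policyE.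
rewrite EslotE; have MR := invsqrt_moment_ge0 gRD0; have MD := invsqrt_moment_ge0 gSD0.
set M := (X in (_ <= X)%E); have M0 : (0 <= M)%E by rewrite lee_fin addr_ge0// !mulr_ge0.
rewrite -[leRHS](Edens_cst t gSR0 M0); apply: le_Edens => [//|a ta|a ta].
  do 2!apply: Edens_ge0 => // ? ?; rewrite lee_fin addr_ge0// !mulr_ge0 ?powR_ge0//.
apply: (@le_trans _ _ (Edens t gSD (fun b => (q + (C * invsqrt_moment gRD) * b `^ (- 2^-1))%:E))).
  apply: le_Edens => [//|b tb|b tb].
    by apply: Edens_ge0 => // ? ?; rewrite lee_fin addr_ge0// !mulr_ge0 ?powR_ge0.
  rewrite [C * _ * _]mulrAC /=; apply: Edens_affine_le => //.
  by rewrite mulr_ge0 ?powR_ge0.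
apply: le_trans (Edens_affine_le gSD0 t0 t1 q0 _) _; first exact: mulr_ge0.
by rewrite lee_fin addrC mulrAC.
Qed.

(** It remains to average the first power over slot 0. Its factors belong to the independent SR and
    SD links, so the moment bounds multiply; [M2] accounts for slot 1. *)
Lemma NMESE_relay_bounded Reff K : 0 < Reff -> (2 <= K)%N ->
  exists M : R, \forall gtr \near 0^'+,
    (NMESE (@relay_obs R) K Reff gSR gSD gRD gtr <= M%:E)%E.
Proof.
case: K => [//|[//|n]] Reff0 _; set B := n.+2%:R * Reff.
have B0 : 0 < B by rewrite mulr_gt0.
set C := expR B - 1; have C0 : 0 <= C by rewrite /C ltW ?subr_gt0 ?expR_gt1.
have MR := invsqrt_moment_ge0 gRD0; have MD := invsqrt_moment_ge0 gSD0.
have MS := invsqrt_moment_ge0 gSR0.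
set M2 := C * invsqrt_moment gSD * invsqrt_moment gRD.
have M20 : 0 <= M2 by rewrite /M2 !mulr_ge0.
exists (n.+2%:R^-1 * (M2 + C * invsqrt_moment gSD * invsqrt_moment gSR)).
near=> t.
have t0 : 0 < t by near: t; exact: nbhs_right_gt.
have t1 : t < 1 by near: t; exact: nbhs_right_lt.
rewrite /NMESE -/B EFinM lee_wpmul2l ?lee_fin//.
apply: (@le_trans _ _ (Defs.Eslot gSR gSD gRD t
    (fun s => (M2 + C * s.1.1 `^ (- 2^-1) * s.1.2 `^ (- 2^-1))%:E))).
  apply: le_Eslot => [//|//|//|s sge|s sge]; last exact: Jstar_relay_le.
  apply: le_ereal_inf_tmp => _ [p [_ [p0 _]] <-].
  by apply: Eiter_ge => // w _; rewrite lee_fin sumr_ge0.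
rewrite EslotE.
apply: (@le_trans _ _ (Edens t gSR (fun a => (M2 + (C * invsqrt_moment gSD) * a `^ (- 2^-1))%:E))); last first.
  by apply: Edens_affine_le => //; rewrite mulr_ge0.
apply: le_Edens => [//|a ta|a ta].
  do 2!apply: Edens_ge0 => // ? ?; rewrite lee_fin addr_ge0// !mulr_ge0 ?powR_ge0//.
rewrite [C * _ * _]mulrAC; apply: le_trans (Edens_affine_le gSD0 t0 t1 M20 _); last first.
  by rewrite mulr_ge0 ?powR_ge0.
apply: le_Edens => [//|b tb|b tb].
  by apply: Edens_ge0 => // ? ?; rewrite lee_fin addr_ge0// !mulr_ge0 ?powR_ge0.
(* The first power does not involve the RD link, so the innermost expectation is that of a
   constant. *)
by rewrite /= Edens_cst ?lee_fin// addr_ge0// !mulr_ge0 ?powR_ge0.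
Unshelve. all: by end_near. Qed.
End upper_bound.

Unset Implicit Arguments.

Theorem theorem3 (R : realType) (Reff gSR gSD gRD : R) :
  0 < Reff -> 0 < gSR -> 0 < gSD -> 0 < gRD ->
  (forall K : nat, (1 <= K)%N ->
     NMESE (@norelay_obs R) K Reff gSR gSD gRD gtr @[gtr --> 0^'+] --> +oo%E) /\
  (forall K : nat, (2 <= K)%N ->
     exists M : R, \forall gtr \near 0^'+,
       (NMESE (@relay_obs R) K Reff gSR gSD gRD gtr <= M%:E)%E).
Proof.
move=> Reff0 gSR0 gSD0 gRD0; split=> K.
- exact: NMESE_norelay_diverges.
- exact: NMESE_relay_bounded.
Qed.
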